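(* Let $X\subseteq\mathbb R^K$ be compact and suppose that: (i) $\sup_{u \in X} \| \mathcal G(u) - m^{\mathcal G}_N(u)\|$, $\sup_{u \in X} | \Phi(u) - m^\Phi_N(u)|$ and $\sup_{u \in X} k_N(u,u)$ (sequences of real numbers indexed by $N\in\mathbb N$) converge to $0$ as $N\to\infty$; (ii) $\sup_{u \in X}\|\mathcal G(u)\| \leq C_{\mathcal G} < \infty$; (iii) for every $N\in\mathbb N$, each of the pairs $(f,g)=(\Phi_N-m_N^\Phi,\ \Phi_0)$ and $(f,g)=(\mathcal G_N^j-m_N^{\mathcal G^j},\ \mathcal G_0^j)$, $j\in\{1,\dots,J\}$, consists of almost surely bounded Gaussian fields on $X$ with $\mathbb E(f(u))=\mathbb E(g(u))$ and $\mathbb E\big((f(u)-f(u'))^2\big)\le\mathbb E\big((g(u)-g(u'))^2\big)$ for all $u,u'\in X$. Then there exist constants $C_1$ and $C_2$, independent of $N$ and of the design points $U_N$, such that for any $\delta>0$ and all $N$ $$\left(\mathbb E_{\nu_N^{\mathcal G}} \left(d_{\mathrm{Hell}}(\mu^y, \mu^{y,N,\mathcal G}_{\mathrm{sample}})^2\right) \right)^{1/2} \leq C_1 \left\|\Big( \mathbb E_{\nu_N^{\mathcal G}} \big(\|\mathcal G - \mathcal G_N \|^{2+ \delta} \big) \Big)^{1/(2+\delta)}\right\|_{L^2_{\mu_0}(X)},$$ $$\left(\mathbb E_{\nu_N^\Phi} \left(d_{\mathrm{Hell}}(\mu^y, \mu^{y,N,\Phi}_{\mathrm{sample}})^2\right)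 \right)^{1/2} \leq C_2 \left\|\Big( \mathbb E_{\nu_N^\Phi} \big(|\Phi - \Phi_N |^{2+\delta} \big) \Big)^{1/(2+\delta)}\right\|_{L^2_{\mu_0}(X)}.$$
   Context: Let $K,J\in\mathbb N$, $X\subseteq\mathbb R^K$, let $\mathcal G=(\mathcal G^1,\dots,\mathcal G^J): X\to\mathbb R^J$ be measurable (the parameter-to-observation map), let $y\in\mathbb R^J$ and $\sigma_\eta^2>0$ be fixed, and let $\mu_0$ be a probability measure on $\mathbb R^K$ with $\mu_0(X)=1$ (the prior). $\|\cdot\|$ is the Euclidean norm. Define $\Phi(u)=\frac1{2\sigma_\eta^2}\|y-\mathcal G(u)\|^2$, $Z=\mathbb E_{\mu_0}(\exp(-\Phi(u)))$, and the posterior $\mu^y$ by $\frac{d\mu^y}{d\mu_0}(u)=\frac1Z\exp(-\Phi(u))$. Gaussian process emulators: $\Phi_0$ and $\mathcal G_0^j$ ($1\le j\le J$) denote the initial (prior) Gaussian process models on $X$ for $\Phi$ and $\mathcal G^j$, and for each $N\in\mathbb N$, $\Phi_N$ and $\mathcal G_N^j$ denote the predictive Gaussian processes obtained by conditioning on the values of $\Phi$, resp. $\mathcal G^j$, at a set $U_N\subseteq X$ of $N$ distinct design points. $\Phi_N$ is a Gaussian process on $X$ with mean function $m_N^\Phi$ and covariance function $k_N$; $\mathcal G_N^j$ is a Gaussian process with mean function $m_N^{\mathcal G^j}$ and the same covariance function $k_N$; the processes $\mathcal G_N^1,\dots,\mathcal G_N^J$ are independent, $\mathcal G_N=(\mathcal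 G_N^1,\dots,\mathcal G_N^J)$ and $m_N^{\mathcal G}=(m_N^{\mathcal G^1},\dots,m_N^{\mathcal G^J})$. All processes have continuous sample paths; $\nu_N^\Phi$ denotes the law of $\Phi_N$ on $C^0(X)$ and $\nu_N^{\mathcal G}=\prod_{j}\nu_N^{\mathcal G^j}$ the law of $\mathcal G_N$ on $C^0(X;\mathbb R^J)$, for $N\in\mathbb N\cup\{0\}$. No particular formula for $m_N^{\mathcal G},m_N^\Phi,k_N$ is assumed; only the hypotheses in the claim are required of the emulators. The expectations $\mathbb E$ in hypothesis (iii) are with respect to the laws of the respective processes. In the conclusion, $\mathbb E_{\nu_N^{\mathcal G}}(\|\mathcal G-\mathcal G_N\|^{2+\delta})$ denotes the function $u\mapsto\mathbb E_{\nu_N^{\mathcal G}}(\|\mathcal G(u)-\mathcal G_N(u)\|^{2+\delta})$, and similarly for $\Phi$. The random approximations of the posterior are the random probability measures (depending on the realisation of $\mathcal G_N$, resp. $\Phi_N$) given by $$\frac{d\mu^{y,N,\mathcal G}_{\mathrm{sample}}}{d\mu_0}(u)=\frac{1}{Z_{N,\mathcal G}^{\mathrm{sample}}}\exp\Big(-\frac1{2\sigma_\eta^2}\|y-\mathcal G_N(u)\|^2\Big),\quad Z_{N,\mathcal G}^{\mathrm{sample}}=\mathbb E_{\mu_0}\Big(\exp\Big(-\frac1{2\sigma_\eta^2}\|y-\mathcal G_N(u)\|^2\Big)\Big),$$ $$\frac{d\mu^{y,N,\Phi}_{\mathrm{sample}}}{d\mu_0}(u)=\frac{1}{Z_{N,\Phi}^{\mathrm{sample}}}\exp(-\Phi_N(u)),\quad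 Z_{N,\Phi}^{\mathrm{sample}}=\mathbb E_{\mu_0}\big(\exp(-\Phi_N(u))\big).$$ The Hellinger distance between probability measures $\mu,\mu'$ absolutely continuous with respect to $\mu_0$ is $d_{\mathrm{Hell}}(\mu,\mu')=\Big(\frac12\int_X\big(\sqrt{d\mu/d\mu_0}-\sqrt{d\mu'/d\mu_0}\big)^2d\mu_0\Big)^{1/2}$. *)

(* Defs.v *)
From HB Require Import structures.
From mathcomp Require Export all_boot all_order all_algebra.
From mathcomp Require Export all_classical all_reals all_analysis.

Set Implicit Arguments.
Unset Strict Implicit.
Unset Printing Implicit Defensive.

Import Order.TTheory GRing.Theory Num.Theory.
Import numFieldNormedType.Exports.

Local Open Scope classical_set_scope.
Local Open Scope ring_scope.

(* R^n with its Borel sigma-algebra. *)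
Notation borel_rV R n := (g_sigma_algebraType (@open 'rV[R]_n)).

(* The library norm on 'rV[R]_n is the sup norm. *)
Definition enorm (R : realType) (n : nat) (v : 'rV[R]_n) : R :=
  Num.sqrt (\sum_(i < n) v 0 i ^+ 2).

Definition sup_on (R : realType) (T : Type) (X : set T) (f : T -> R) : \bar R :=
  ereal_sup [set (f u)%:E | u in X].

(* ||h||_{L^2_mu(X)}, for an extended-real valued h. *)
Definition L2norm (R : realType) d (T : measurableType d)
    (mu : probability T R) (X : set T) (h : T -> \bar R) : \bar R :=
  Lnorm mu 2%:E (h \_ X).

Section bayesian_posterior.
Context (R : realType) (d : measure_display) (T : measurableType d).
Variables (mu0 : probability T R) (X : set T).

Definition evidence (phi : T -> R) : R := \int[mu0]_(u in X) expR (- phi u).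

Definition is_posterior (phi : T -> R) (mu : probability T R) : Prop :=
  forall A, measurable A ->
    mu A = (\int[mu0]_(u in A `&` X) (expR (- phi u) / evidence phi)%:E)%E.

(* When no probability measure has density exp(-phi)/Z, i.e. when phi is
   not measurable or Z is 0 or infinite, the value is the junk value mu0. *)
Definition posterior (phi : T -> R) : probability T R :=
  if pselect (exists mu, is_posterior phi mu) is left h then sval (cid h)
  else mu0.

Definition density (mu : probability T R) (u : T) : R :=
  fine (Radon_Nikodym (charge_of_finite_measure mu) mu0 u).

Definition hellinger (mu mu' : probability T R) : R :=
  Num.sqrt (2^-1 * \int[mu0]_(u in X)
    (Num.sqrt (density mu u) - Num.sqrt (density mu' u)) ^+ 2).

End bayesian_posterior.

(* Gaussian law with mean m and variance v, a Dirac mass when v = 0 (the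
   library's [normal_prob m 0] is a uniform law). *)
Definition normal_law (R : realType) (m v : R) : set R -> \bar R :=
  if v == 0 then \d_m else normal_prob m (Num.sqrt v).

Section random_fields.
Context (R : realType) (V : topologicalType) (X : set V).
Context (d : measure_display) (Omega : measurableType d).
Variable P : probability Omega R.
Implicit Types (f : V -> Omega -> R) (m : V -> R) (k : V -> V -> R).

Definition covariance_function k : Prop :=
  (forall u u', X u -> X u' -> k u u' = k u' u) /\
  (forall n (u : 'I_n -> V) (a : 'I_n -> R), (forall i, X (u i)) ->
     0 <= \sum_(i < n) \sum_(j < n) a i * a j * k (u i) (u j)).

(* Joint normality of f(u_1), ..., f(u_n) with mean vector m(u_i) and
   covariance matrix k(u_i, u_j), expressed on linear combinations so as to
   allow singular covariance matrices (e.g. k(u, u) = 0 at a design point). *)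
Definition gaussian_process f m k : Prop :=
  [/\ forall u, X u -> measurable_fun setT (f u),
      covariance_function k &
      forall n (u : 'I_n -> V) (a : 'I_n -> R), (forall i, X (u i)) ->
      forall B : set R, measurable B ->
        P [set w | B (\sum_(i < n) a i * f (u i) w)] =
        normal_law (\sum_(i < n) a i * m (u i))
          (\sum_(i < n) \sum_(j < n) a i * a j * k (u i) (u j)) B].

Definition continuous_paths f : Prop :=
  forall w, {within X, continuous (f ^~ w)}.

Definition as_bounded f : Prop :=
  {ae P, forall w, exists M, forall u, X u -> `|f u w| <= M}.

Definition bounded_gaussian_field f : Prop :=
  (exists m k, gaussian_process f m k) /\ as_bounded f.

Definition generated_events f : set (set Omega) :=
  <<s [set f u @^-1` B | u in X & B in (@measurable _ R)] >>.

Definition independent_fields (J : nat) (g : 'I_J -> V -> Omega -> R) : Prop :=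
  forall A : 'I_J -> set Omega, (forall j, generated_events (g j) (A j)) ->
    P (\bigcap_j A j) = (\prod_(j < J) P (A j))%E.

Definition gaussian_emulator (J : nat)
    (Phi : V -> Omega -> R) (mPhi : V -> R)
    (g : 'I_J -> V -> Omega -> R) (mg : V -> 'rV[R]_J) k : Prop :=
  [/\ gaussian_process Phi mPhi k,
      continuous_paths Phi,
      forall j, gaussian_process (g j) (fun u => mg u 0 j) k,
      forall j, continuous_paths (g j) &
      independent_fields g].

End random_fields.

(* The hypotheses of the Sudakov-Fernique comparison inequality; the two
   fields may live on different probability spaces. *)
Definition sudakov_fernique (R : realType) (V : topologicalType) (X : set V)
    d (Omega : measurableType d) (P : probability Omega R)
    d' (Omega' : measurableType d') (P' : probability Omega' R)
    (f : V -> Omega -> R) (g : V -> Omega' -> R) : Prop :=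
  [/\ bounded_gaussian_field X P f,
      bounded_gaussian_field X P' g,
      forall u, X u -> ('E_P[f u] = 'E_P'[g u])%E &
      forall u u', X u -> X u' ->
        ('E_P[fun w => ((f u w - f u' w) ^+ 2)%R]
           <= 'E_P'[fun w => ((g u w - g u' w) ^+ 2)%R])%E].

Definition is_design (V : eqType) (X : set V) (N : nat) (D : seq V) : Prop :=
  [/\ size D = N, uniq D & forall u, u \in D -> X u].

(* The negative log-likelihood |y - z|^2 / (2 sigma2) of an observation z. *)
Definition misfit (R : realType) (J : nat) (y : 'rV[R]_J) (sigma2 : R)
    (z : 'rV[R]_J) : R := enorm (y - z) ^+ 2 / (2 * sigma2).

(* Main.v *)
From HB Require Import structures.
From mathcomp Require Import measurable_realfun ring lra.
Require Import Defs.

Set Implicit Arguments.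
Unset Strict Implicit.
Unset Printing Implicit Defensive.

Import Order.TTheory GRing.Theory Num.Theory.
Import numFieldNormedType.Exports.

Local Open Scope classical_set_scope.
Local Open Scope ring_scope.

(** Both estimates are reduced to one point [u] of [X] at a time.

    Write [a = exp (- phi / 2)] and [b = exp (- psi / 2)] for the square roots of
    two unnormalised densities.  In L2(mu0) the Hellinger distance measures the
    angle [theta] between [a] and [b]: its square is [1 - cos theta].  The
    squared distance from [a] to the line spanned by [b] is
    [|a|^2 (1 - cos^2 theta)], and [cos theta >= 0] because [a] and [b] are
    positive, so

      hellinger^2 <= 1 - cos^2 theta <= |a - b|^2 / |a|^2,

    where [|a|^2] is the evidence of [phi] ([hellinger_sqr_le]): the random
    normalising constant has disappeared from the bound.  A field with continuous
    paths over a compact set is jointly measurable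
    ([caratheodory_measurable]), so Tonelli's theorem applies and the expected
    squared distance is at most [1 / evidence] times the integral over [X] of
    [E (a u - b u)^2] ([expected_hellinger_le]).

    It remains to bound [E (a u - b u)^2] by a constant times the mean square
    error at [u].  For the emulator of [G], the function
    [z |-> exp (- |y - z|^2 / (4 sigma2))] is globally Lipschitz
    ([expR_misfit_lipschitz]).  For the emulator of [Phi], the difference
    [a u - b u] is not Lipschitz in the emulated value, but that value is normal:
    the weight [exp (- x)] shifts a normal density by its variance, and the
    variance is itself bounded by a multiple of the mean square error
    ([gaussian_expR_sub_le]).  The constant there depends only on bounds for the
    bias and for the variance, which hypothesis (i) makes uniform in N.

    Finally Lyapunov's inequality ([lyapunov_sqr]) replaces second moments by
    moments of order [2 + delta] with constant 1, which is why the constants do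
    not depend on [delta]. *)

(** * Auxiliary integration facts *)

(** The integral of a nonnegative function is a supremum over the simple
    functions below it, hence monotone without any measurability.  It is applied
    to the Hellinger distance as a function of the realisation, and to the
    integrand of the L2 norm, so that their measurability need not be
    established. *)
Lemma ge0_le_integral_nonmeasurable d (T : measurableType d) (R : realType)
    (mu : {measure set T -> \bar R}) (D : set T) (f g : T -> \bar R) :
  (forall x, D x -> 0 <= f x)%E -> (forall x, D x -> f x <= g x)%E ->
  (\int[mu]_(x in D) f x <= \int[mu]_(x in D) g x)%E.
Proof.
move=> f0 fg.
have g0 x : D x -> (0 <= g x)%E.
  by move=> Dx; rewrite (le_trans (f0 x Dx) (fg x Dx)).
rewrite !ge0_integralE//; apply: le_ereal_sup => _ [h hf <-]; exists h => // x.
rewrite (le_trans (hf x))// /patch; case: ifPn => // /set_mem; exact: fg.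
Qed.

Lemma measurable_sqrt (R : realType) : measurable_fun [set: R] (@Num.sqrt R).
Proof. apply: continuous_measurable_fun; exact: sqrt_continuous. Qed.

Section bounded.
Context (R : realType) (d : measure_display) (T : measurableType d).
Variables (mu0 : probability T R) (X : set T).
Hypothesis mX : measurable X.

Lemma bounded_integrable (f : T -> R) (M : R) : measurable_fun X f ->
  (forall u, X u -> `|f u| <= M) -> mu0.-integrable X (EFin \o f).
Proof.
move=> mf fM; apply: measurable_bounded_integrable => //.
  by rewrite (le_lt_trans (probability_le1 _ _)) ?ltry.
exists M; split; first exact: num_real.
by move=> N MN u Xu /=; rewrite (le_trans (fM u Xu)) ?ltW.
Qed.

End bounded.

Lemma gibbs_le (R : realType) (T : Type) (X : set T) (phi : T -> R) (M : R) :
  (forall u, X u -> `|phi u| <= M) ->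
  forall c u, X u -> expR (c * phi u) <= expR (`|c| * M).
Proof.
move=> phiM c u Xu; rewrite ler_expR (le_trans (ler_norm _))// normrM.
by rewrite ler_wpM2l// phiM.
Qed.

(** * Posterior densities and the Hellinger distance *)

Lemma sqr_diff_sqrt_density (R : realType) (Z W a b : R) :
  0 < Z -> 0 < W -> 0 <= a -> 0 <= b ->
  (Num.sqrt (a ^+ 2 / Z) - Num.sqrt (b ^+ 2 / W)) ^+ 2 =
  Z^-1 * (a * a) + W^-1 * (b * b) +
  (- 2 / (Num.sqrt Z * Num.sqrt W)) * (a * b).
Proof.
move=> Z0 W0 a0 b0.
rewrite !(sqrtrM _ (sqr_ge0 _)) !sqrtr_sqr !sqrtrV ?ltW// !ger0_norm//.
have : 0 < Num.sqrt W by rewrite sqrtr_gt0.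
have : 0 < Num.sqrt Z by rewrite sqrtr_gt0.
have := sqr_sqrtr (ltW W0); have := sqr_sqrtr (ltW Z0).
move: (Num.sqrt Z) (Num.sqrt W) => al be <- <- al0 be0.
by field; rewrite !gt_eqF.
Qed.

(** With [Z = |a|^2], [W = |b|^2] and [c = <a, b>], the quotient
    [s = c / (|a| |b|)] is the cosine of the angle between [a] and [b].  The
    right-hand side is [1 - s^2 + (r - s)^2] for [r = |b| / |a|], and
    [1 - s^2 >= 1 - s] because [0 <= s <= 1]. *)
Lemma one_minus_cos_le (R : realType) (Z W c : R) : 0 < Z -> 0 < W -> 0 <= c ->
  0 <= 2 - 2 * (c / (Num.sqrt Z * Num.sqrt W)) ->
  2^-1 * (2 - 2 * (c / (Num.sqrt Z * Num.sqrt W))) <= (Z + W - 2 * c) / Z.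
Proof.
move=> Z0 W0 c0.
have : 0 < Num.sqrt W by rewrite sqrtr_gt0.
have : 0 < Num.sqrt Z by rewrite sqrtr_gt0.
have := sqr_sqrtr (ltW W0); have := sqr_sqrtr (ltW Z0).
move: (Num.sqrt Z) (Num.sqrt W) => al be <- <- al0 be0.
set s := c / _ => s1.
have s0 : 0 <= s by rewrite divr_ge0// mulr_ge0// ltW.
pose r := be / al.
have -> : (al ^+ 2 + be ^+ 2 - 2 * c) / al ^+ 2 = 1 + r ^+ 2 - 2 * r * s.
  by rewrite /r /s; field; rewrite !gt_eqF.
have : 0 <= (r - s) ^+ 2 by exact: sqr_ge0.
have : 0 <= s * (1 - s) by rewrite mulr_ge0//; lra.
by nra.
Qed.

Section posterior_density.
Context (R : realType) (d : measure_display) (T : measurableType d).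
Variables (mu0 : probability T R) (X : set T).
Hypothesis (mX : measurable X) (X1 : mu0 X = 1%E).

Section one_potential.
Variables (phi : T -> R) (M : R).
Hypotheses (mphi : measurable_fun X phi)
  (phiM : forall u, X u -> `|phi u| <= M).

Lemma measurable_gibbs (c : R) : measurable_fun X (fun u => expR (c * phi u)).
Proof. by apply: measurableT_comp => //; exact: measurable_funM. Qed.

Lemma gibbs_integrable (c : R) :
  mu0.-integrable X (EFin \o (fun u => expR (c * phi u))).
Proof.
apply: (@bounded_integrable _ _ _ mu0 X mX _ (expR (`|c| * M))) => //.
  exact: measurable_gibbs.
by move=> u Xu; rewrite ger0_norm ?expR_ge0// (gibbs_le phiM _ Xu).
Qed.

Lemma evidence_gt0 : 0 < evidence mu0 X phi.
Proof.
apply: (@lt_le_trans _ _ (expR (- M))); first exact: expR_gt0.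
have -> : expR (- M) = \int[mu0]_(u in X) (cst (expR (- M)) u).
  by rewrite Rintegral_cst//= X1 /= mulr1.
apply: le_Rintegral => //.
- apply: (@bounded_integrable _ _ _ mu0 X mX _ (expR (- M))) => // u _.
  by rewrite /= ger0_norm ?expR_ge0.
- have := gibbs_integrable (- 1); congr (_.-integrable _ _).
  by apply/funext => u /=; rewrite mulN1r.
- by move=> u Xu; rewrite /= ler_expR lerN2 (le_trans (ler_norm _))// phiM.
Qed.

Let p u := expR (- phi u) / evidence mu0 X phi.

Let mp : measurable_fun X p.
Proof.
apply: measurable_funM => //.
have := measurable_gibbs (- 1); congr measurable_fun.
by apply/funext => u /=; rewrite mulN1r.
Qed.

Let p_ge0 u : 0 <= p u.
Proof. by rewrite divr_ge0 ?expR_ge0// ltW// evidence_gt0. Qed.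

Let p_integrable : mu0.-integrable X (EFin \o p).
Proof.
apply: (@bounded_integrable _ _ _ mu0 X mX _ (expR M / evidence mu0 X phi)).
  exact: mp.
move=> u Xu; rewrite ger0_norm // /p ler_wpM2r//.
  by rewrite invr_ge0 ltW// evidence_gt0.
by have := gibbs_le phiM (- 1) Xu; rewrite normrN1 mul1r; rewrite mulN1r.
Qed.

Let int_p : (\int[mu0]_(u in X) (p u)%:E = 1)%E.
Proof.
have iE : mu0.-integrable X (EFin \o (fun u => expR (- phi u))).
  have := gibbs_integrable (- 1); congr (_.-integrable _ _).
  by apply/funext => u /=; rewrite mulN1r.
rewrite -[LHS]fineK ?integrable_fin_num//.
rewrite -/(Rintegral mu0 X p) RintegralZr// -/(evidence mu0 X phi).
by rewrite divff// gt_eqF// evidence_gt0.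
Qed.

Lemma posterior_exists : exists mu : probability T R, is_posterior mu0 X phi mu.
Proof.
pose m (A : set T) := (\int[mu0]_(u in A `&` X) (p u)%:E)%E.
have m0 : m set0 = 0%E by rewrite /m set0I integral_set0.
have mge0 A : (0 <= m A)%E by apply: integral_ge0 => u _; rewrite lee_fin.
have msa : semi_sigma_additive m.
  move=> A mA tA mUA; rewrite /m setI_bigcupl integral_bigcup//; last first.
  - apply: integrableS p_integrable => //.
    + by apply: bigcup_measurable => n _; exact: measurableI.
    + by move=> u [n _ []].
  - by move=> n; exact: measurableI.
  - exact: trivIset_setIr tA.
  apply: is_cvg_ereal_nneg_natsum_cond => n _ _; exact: mge0.
pose mm : {measure set T -> \bar R} :=
  HB.pack m (isMeasure.Build _ _ _ m m0 mge0 msa).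
have mT : m setT = 1%E by rewrite /m setTI int_p.
pose mp' : probability T R :=
  HB.pack m (isMeasure.Build _ _ _ m m0 mge0 msa)
    (@Measure_isProbability.Build _ _ R mm mT).
by exists mp'.
Qed.

(** For a bounded measurable potential [posterior] is therefore not its junk
    value, and [mu_y] and the emulated posteriors are the intended measures. *)
Lemma posteriorP : is_posterior mu0 X phi (posterior mu0 X phi).
Proof.
rewrite /posterior; case: pselect => [h|/(_ posterior_exists)//].
exact: (svalP (cid h)).
Qed.

Lemma posterior_dominated : posterior mu0 X phi `<< mu0.
Proof.
apply/null_content_dominatesP => A mA A0; rewrite posteriorP//.
apply: null_set_integral.
- exact: measurableI.
- by apply/measurable_EFinP; apply: measurable_funS mp.
- by apply: subset_measure0 A0 => //; exact: measurableI.
Qed.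

Lemma measurable_density : measurable_fun X (density mu0 (posterior mu0 X phi)).
Proof.
apply: measurable_funTS; apply: measurableT_comp => //.
apply: measurable_int; apply: Radon_Nikodym_integrable.
exact: posterior_dominated.
Qed.

Lemma ae_density_posterior : {ae mu0, forall u, X u ->
  density mu0 (posterior mu0 X phi) u = expR (- phi u) / evidence mu0 X phi}.
Proof.
have dom := posterior_dominated.
have : ae_eq mu0 X (EFin \o p)
    (Radon_Nikodym (charge_of_finite_measure (posterior mu0 X phi)) mu0).
  apply: integral_ae_eq => //.
    apply: measurable_funTS; apply: measurable_int.
    exact: Radon_Nikodym_integrable.
  move=> E EX mE; rewrite -Radon_Nikodym_integral//.
  have := posteriorP mE; rewrite setIidl// => <-.
apply: filterS => u + Xu => /(_ Xu) /= pE.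
by rewrite /density -pE.
Qed.

End one_potential.

Lemma Rintegral_lin3 (A B C : T -> R) (x y z : R) :
  mu0.-integrable X (EFin \o A) -> mu0.-integrable X (EFin \o B) ->
  mu0.-integrable X (EFin \o C) ->
  \int[mu0]_(u in X) (x * A u + y * B u + z * C u) =
  x * \int[mu0]_(u in X) A u + y * \int[mu0]_(u in X) B u +
  z * \int[mu0]_(u in X) C u.
Proof.
move=> iA iB iC.
have iZ (f : T -> R) r : mu0.-integrable X (EFin \o f) ->
    mu0.-integrable X (EFin \o (fun u => r * f u)).
  by move=> i_f; exact: (integrableZl mX r i_f).
rewrite RintegralD//; last 2 first.
- exact: (integrableD mX (iZ _ x iA) (iZ _ y iB)).
- exact: iZ.
by rewrite RintegralD// ?RintegralZl//; exact: iZ.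
Qed.

(** Only the evidence of [phi] appears: the normalising constant of [psi] cancels
    in the angle between the two root densities, see [one_minus_cos_le]. *)
Lemma hellinger_sqr_le (phi psi : T -> R) (M N : R) :
  measurable_fun X phi -> (forall u, X u -> `|phi u| <= M) ->
  measurable_fun X psi -> (forall u, X u -> `|psi u| <= N) ->
  hellinger mu0 X (posterior mu0 X phi) (posterior mu0 X psi) ^+ 2 <=
  (\int[mu0]_(u in X)
     (expR (- 2^-1 * phi u) - expR (- 2^-1 * psi u)) ^+ 2) / evidence mu0 X phi.
Proof.
move=> mphi phiM mpsi psiN.
set a := fun u => expR (- 2^-1 * phi u).
set b := fun u => expR (- 2^-1 * psi u).
have a2 u : a u ^+ 2 = expR (- phi u).
  by rewrite /a expr2 -expRD; congr expR; field.
have b2 u : b u ^+ 2 = expR (- psi u).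
  by rewrite /b expr2 -expRD; congr expR; field.
have ma : measurable_fun X a by exact: measurable_gibbs.
have mb : measurable_fun X b by exact: measurable_gibbs.
pose A := expR (`|- 2^-1| * M); pose B := expR (`|- 2^-1| * N).
have aA u : X u -> `|a u| <= A.
  by move=> Xu; rewrite ger0_norm ?expR_ge0//; exact: (gibbs_le phiM _ Xu).
have bB u : X u -> `|b u| <= B.
  by move=> Xu; rewrite ger0_norm ?expR_ge0//; exact: (gibbs_le psiN _ Xu).
have ifg (f g : T -> R) (F G : R) : measurable_fun X f -> measurable_fun X g ->
    (forall u, X u -> `|f u| <= F) -> (forall u, X u -> `|g u| <= G) ->
    mu0.-integrable X (EFin \o (fun u => f u * g u)).
  move=> mf mg fF gG.
  apply: (@bounded_integrable _ _ _ mu0 X mX _ (F * G)).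
    exact: measurable_funM.
  by move=> u Xu; rewrite normrM ler_pM// ?fF ?gG.
have iaa := ifg a a A A ma ma aA aA.
have ibb := ifg b b B B mb mb bB bB.
have iab := ifg a b A B ma mb aA bB.
set Z := evidence mu0 X phi; set W := evidence mu0 X psi.
have Z0 : 0 < Z by exact: evidence_gt0 mphi phiM.
have W0 : 0 < W by exact: evidence_gt0 mpsi psiN.
have ZE : \int[mu0]_(u in X) (a u * a u) = Z.
  by apply: eq_Rintegral => u _; rewrite -expr2 a2.
have WE : \int[mu0]_(u in X) (b u * b u) = W.
  by apply: eq_Rintegral => u _; rewrite -expr2 b2.
set c := \int[mu0]_(u in X) (a u * b u).
have c0 : 0 <= c by apply: Rintegral_ge0 => u _; rewrite mulr_ge0 ?expR_ge0.
have -> : \int[mu0]_(u in X) (a u - b u) ^+ 2 = Z + W - 2 * c.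
  rewrite -ZE -WE /c -[X in X + _ - _]mul1r -[X in _ + X - _]mul1r -mulNr.
  by rewrite -Rintegral_lin3//; apply: eq_Rintegral => u _; ring.
have sqr_diff u : density mu0 (posterior mu0 X phi) u = expR (- phi u) / Z ->
    density mu0 (posterior mu0 X psi) u = expR (- psi u) / W ->
    (Num.sqrt (density mu0 (posterior mu0 X phi) u) -
      Num.sqrt (density mu0 (posterior mu0 X psi) u)) ^+ 2 =
    Z^-1 * (a u * a u) + W^-1 * (b u * b u) +
    (- 2 / (Num.sqrt Z * Num.sqrt W)) * (a u * b u).
  move=> dphi dpsi.
  have a0 : 0 <= a u by exact: expR_ge0.
  have b0 : 0 <= b u by exact: expR_ge0.
  have <- := sqr_diff_sqrt_density Z0 W0 a0 b0.
  rewrite a2 b2; congr ((Num.sqrt _ - Num.sqrt _) ^+ 2); [exact: dphi|].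
  exact: dpsi.
have HE : \int[mu0]_(u in X)
    (Num.sqrt (density mu0 (posterior mu0 X phi) u) -
     Num.sqrt (density mu0 (posterior mu0 X psi) u)) ^+ 2 =
    2 - 2 * (c / (Num.sqrt Z * Num.sqrt W)).
  transitivity (\int[mu0]_(u in X) (Z^-1 * (a u * a u) + W^-1 * (b u * b u)
      + (- 2 / (Num.sqrt Z * Num.sqrt W)) * (a u * b u))); last first.
    rewrite Rintegral_lin3// ZE WE -/c !mulVf ?gt_eqF//.
    by rewrite mulNr mulNr mulrAC mulrA.
  rewrite /Rintegral; congr fine; apply: ae_eq_integral => //.
  - apply/measurable_EFinP; apply: measurable_funX; apply: measurable_funB.
    + apply: measurableT_comp; first exact: measurable_sqrt.
      exact: measurable_density mphi phiM.
    + apply: measurableT_comp; first exact: measurable_sqrt.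
      exact: measurable_density mpsi psiN.
  - apply/measurable_EFinP.
    by do ![apply: measurable_funD|apply: measurable_funM|
            exact: measurable_cst].
  have := ae_density_posterior mphi phiM.
  have := ae_density_posterior mpsi psiN.
  apply: filterS2 => u psiE phiE Xu.
  by rewrite (sqr_diff u (phiE Xu) (psiE Xu)).
rewrite /hellinger sqr_sqrtr; last first.
  by rewrite mulr_ge0//; apply: Rintegral_ge0 => u _; exact: sqr_ge0.
rewrite HE; apply: one_minus_cos_le => //.
by rewrite -HE; apply: Rintegral_ge0 => u _; exact: sqr_ge0.
Qed.

End posterior_density.

(** * Joint measurability of random fields with continuous paths *)

Section caratheodory.
Context (R : realType) (K : nat) (X : set 'rV[R]_K).
Context d (Omega : measurableType d).
Hypothesis cX : compact X.

Lemma measurable_open_rV (A : set 'rV[R]_K) : open A ->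
  measurable (A : set (borel_rV R K)).
Proof. exact: sub_sigma_algebra. Qed.

Lemma measurable_compact_rV : measurable (X : set (borel_rV R K)).
Proof.
rewrite -[X]setCK; apply: measurableC; apply: measurable_open_rV.
apply: closed_openC; apply: compact_closed => //; exact: norm_hausdorff.
Qed.

Lemma compact_net (r : R) : 0 < r -> exists s : seq 'rV[R]_K,
  (forall x, x \in s -> X x) /\
  (forall u, X u -> exists2 x, x \in s & `|u - x| < r).
Proof.
move=> r0; move: cX; rewrite compact_cover => /(_ _ X (fun x => ball x r)).
case.
- by move=> i _; exact: ball_open.
- by move=> u Xu; exists u => //; exact: ballxx.
move=> D DX XD; exists (finmap.enum_fset D); split.
  by move=> x xD; apply: set_mem; exact: DX.
move=> u /XD [x /= xD xu]; exists x => //.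
by move: xu; rewrite -ball_normE /ball_/= distrC.
Qed.

(** The field read at the first point of the net [s] within distance [r] of the
    argument.  Choosing the first one keeps the selection of the net point
    measurable. *)
Fixpoint net_eval (f : 'rV[R]_K -> Omega -> R) (r : R) (s : seq 'rV[R]_K)
    (z : borel_rV R K * Omega) : R :=
  if s is x :: s' then
    if `|(z.1 : 'rV[R]_K) - x| < r then f x z.2 else net_eval f r s' z
  else 0.

Lemma measurable_net_eval f r s :
  (forall x, x \in s -> measurable_fun setT (f x)) ->
  measurable_fun setT (net_eval f r s).
Proof.
elim: s => [|x s IH] mf /=; first exact: measurable_cst.
apply: measurable_fun_ifT.
- apply: (measurable_fun_bool true).
  rewrite setTI [X in measurable X](_ : _ = fst @^-1` (ball x r)); last first.
    by apply/seteqP; split => z /=; rewrite -ball_normE /ball_/= distrC.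
  rewrite -[X in measurable X]setTI; apply: measurable_fst => //.
  by apply: measurable_open_rV; exact: ball_open.
- by apply: measurableT_comp => //; apply: mf; rewrite mem_head.
- by apply: IH => y ys; apply: mf; rewrite inE ys orbT.
Qed.

Lemma net_evalP f r s u w : (exists2 x, x \in s & `|u - x| < r) ->
  exists x, [/\ x \in s, `|u - x| < r & net_eval f r s (u, w) = f x w].
Proof.
elim: s => [[]//|y s IH] [x] /=; rewrite inE => /predU1P[->|xs] ux.
  by exists y; split; rewrite ?mem_head// ux.
case: ifPn => [uy|_]; first by exists y; split; rewrite ?mem_head.
have [|z [zs uz ->]] := IH; first by exists x.
by exists z; rewrite inE zs orbT.
Qed.

(** The field is the pointwise limit of its values at the points of finer and
    finer finite nets, and each such approximation is a finite gluing of products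
    of Borel sets with random variables. *)
Lemma caratheodory_measurable (f : 'rV[R]_K -> Omega -> R) :
  (forall u, X u -> measurable_fun setT (f u)) ->
  (forall w, {within X, continuous (f ^~ w)}) ->
  measurable_fun (X `*` setT : set (borel_rV R K * Omega))
    (fun z => f z.1 z.2).
Proof.
move=> mf cf.
have nP n : exists s : seq 'rV[R]_K, (forall x, x \in s -> X x) /\
    (forall u, X u -> exists2 x, x \in s & `|u - x| < n.+1%:R^-1).
  by apply: compact_net; rewrite invr_gt0.
pose s n := sval (cid (nP n)).
have sP n : _ := svalP (cid (nP n)).
apply: (@measurable_fun_cvg _ _ _ _ (fun n => net_eval f n.+1%:R^-1 (s n))).
  move=> n; apply: measurable_funTS; apply: measurable_net_eval => x xs.
  by apply: mf; have [+ _] := sP n; apply.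
move=> [u w] [/= Xu _]; apply/cvgrPdist_lt => e e0.
have /subspace_continuousP/(_ u Xu)/cvgrPdist_lt/(_ e e0) := cf w.
rewrite /= /within/= => /nbhs_ballP[r /= r0 rP].
have : \forall n \near \oo, (n.+1%:R^-1 : R) < r.
  exact: near_infty_natSinv_lt (PosNum r0).
apply: filterS => n nr.
have [+ /(_ u Xu)] := sP n => sX.
move=> /(net_evalP f w)[x [xs ux ->]].
apply: rP; last exact: sX.
by rewrite -ball_normE /ball_/=; exact: lt_trans nr.
Qed.

End caratheodory.

Section sections_and_cylinders.
Context d1 d2 d3 (T1 : measurableType d1) (T2 : measurableType d2)
  (T3 : measurableType d3).

Lemma measurable_section (A : set T1) (f : T1 * T2 -> T3) (w : T2) :
  measurable A -> measurable_fun (A `*` setT) f ->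
  measurable_fun A (fun u => f (u, w)).
Proof.
move=> mA mf; apply: (measurable_comp _ _ mf (g := fun u => (u, w))).
- exact: measurableX.
- by move=> _ [u Xu <-].
- by apply: measurable_funTS; exact: pair2_measurable.
Qed.

Lemma measurable_cylinder (A : set T1) (f : T1 -> T3) :
  measurable A -> measurable_fun A f ->
  measurable_fun (A `*` [set: T2]) (fun z => f z.1).
Proof.
move=> mA mf; apply: (measurable_comp mA _ mf (g := fst)).
  by move=> _ [z [Xz _] <-].
by apply: measurable_funTS; exact: measurable_fst.
Qed.

End sections_and_cylinders.
Arguments measurable_cylinder {d1 d2 d3 T1} T2 {T3 A f}.

(** * The expected squared Hellinger distance *)

Section expected_hellinger.
Context (R : realType) (K : nat) (X : set 'rV[R]_K).
Context d (Omega : measurableType d) (P : probability Omega R).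
Variable mu0 : probability (borel_rV R K) R.
Hypotheses (cX : compact X) (X1 : mu0 X = 1%E).
Variables (phi : 'rV[R]_K -> R) (M : R) (psi : 'rV[R]_K -> Omega -> R).
Hypotheses (mphi : @measurable_fun _ _ (borel_rV R K) _ X phi)
  (phiM : forall u, X u -> `|phi u| <= M).
Hypotheses (mpsi : forall u, X u -> measurable_fun setT (psi u))
  (cpsi : continuous_paths X psi).

Let mX : measurable (X : set (borel_rV R K)).
Proof. exact: measurable_compact_rV. Qed.

Let mpsi2 : measurable_fun (X `*` setT : set (borel_rV R K * Omega))
  (fun z => psi z.1 z.2).
Proof. exact: caratheodory_measurable. Qed.

Let mXT : measurable (X `*` setT : set (borel_rV R K * Omega)).
Proof. exact: measurableX. Qed.

Let mpsi1 w : @measurable_fun _ _ (borel_rV R K) _ X (psi^~ w).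
Proof. exact: (measurable_section w mX mpsi2). Qed.

Let psi_bounded w : exists N, forall u, X u -> `|psi u w| <= N.
Proof.
have /continuous_compact/(_ cX)/compact_bounded[N] :
  {within X, continuous (psi^~ w)} by exact: cpsi.
move=> [ [_ /(_ (N + 1))]]; rewrite ltrDl ltr01 => /(_ isT) N1.
by exists (N + 1) => u Xu; apply: N1; exists u.
Qed.

Let F u w := (expR (- 2^-1 * phi u) - expR (- 2^-1 * psi u w)) ^+ 2.

Let mF : measurable_fun (X `*` setT : set (borel_rV R K * Omega))
  (fun z => F z.1 z.2).
Proof.
apply: measurable_funX; apply: measurable_funB.
  exact: (measurable_cylinder Omega mX (measurable_gibbs mphi (- 2^-1))).
by apply: measurableT_comp => //; exact: measurable_funM.
Qed.

Let f : borel_rV R K * Omega -> \bar R :=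
  (fun z : borel_rV R K * Omega => (F z.1 z.2)%:E) \_ (X `*` setT).

Let f0 z : (0 <= f z)%E.
Proof. by apply: erestrict_ge0 => ? _; rewrite lee_fin sqr_ge0. Qed.

Let mf : measurable_fun setT f.
Proof.
by apply/(measurable_restrictT _ mXT); exact/measurable_EFinP.
Qed.

Let fE u w : f (u, w) = ((fun u => (F u w)%:E) \_ X) u.
Proof. by rewrite /f /patch in_setX in_setT andbT. Qed.

(** Tonelli's theorem applied to the pathwise bound [hellinger_sqr_le]: what is
    left to estimate is the one-point expectation under the integral. *)
Lemma expected_hellinger_le :
  ('E_P[fun w => (hellinger mu0 X (posterior mu0 X phi)
                   (posterior mu0 X (psi^~ w)) ^+ 2)%R]
   <= ((evidence mu0 X phi)^-1)%:E *
      \int[mu0]_(u in X) 'E_P[fun w => F u w])%E.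
Proof.
have Z0 : 0 < evidence mu0 X phi by exact: (evidence_gt0 mX X1 mphi phiM).
have hw w : ((hellinger mu0 X (posterior mu0 X phi)
      (posterior mu0 X (psi^~ w)) ^+ 2)%:E <=
    ((evidence mu0 X phi)^-1)%:E * \int[mu0]_u f (u, w))%E.
  have [N psiN] := psi_bounded w.
  have -> : (\int[mu0]_u f (u, w) = (\int[mu0]_(u in X) F u w)%:E)%E.
    rewrite (eq_integral _ _ (fun u _ => fE u w)) -integral_mkcond fineK//.
    apply: integrable_fin_num => //.
    apply: (@bounded_integrable _ _ _ mu0 X mX _
      ((expR (`|- 2^-1| * M) + expR (`|- 2^-1| * N)) ^+ 2)).
      apply: measurable_funX; apply: measurable_funB; exact: measurable_gibbs.
    move=> u Xu; rewrite normrX ler_sqr ?nnegrE ?addr_ge0 ?expR_ge0//.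
    rewrite (le_trans (ler_normB _ _))//.
    apply: lerD; rewrite [leLHS]ger0_norm ?expR_ge0//.
      exact: (gibbs_le phiM _ Xu).
    exact: (gibbs_le psiN _ Xu).
  rewrite -EFinM lee_fin mulrC.
  exact: (hellinger_sqr_le mX X1 mphi phiM (mpsi1 w) psiN).
rewrite unlock.
apply: (@le_trans _ _ (\int[P]_w (((evidence mu0 X phi)^-1)%:E *
    \int[mu0]_u f (u, w)))%E).
  by apply: ge0_le_integral_nonmeasurable => w _ //; rewrite lee_fin sqr_ge0.
rewrite ge0_integralZl//; last 3 first.
- exact: measurable_fun_fubini_tonelli_G.
- by move=> w _; exact: integral_ge0.
- by rewrite lee_fin invr_ge0 ltW.
rewrite -fubini_tonelli// [in leRHS]integral_mkcond.
rewrite lee_wpmul2l//; first by rewrite lee_fin invr_ge0 ltW.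
rewrite le_eqVlt; apply/orP; left; apply/eqP.
apply: eq_integral => u _; rewrite /patch; case: ifPn => uX.
  by apply: eq_integral => w _; rewrite fE /patch uX.
by apply: integral0_eq => w _; rewrite fE /patch (negbTE uX).
Qed.

Lemma measurable_expected_sqr :
  @measurable_fun _ _ (borel_rV R K) _ X (fun u => 'E_P[fun w => F u w]%E).
Proof.
have := measurable_fun_fubini_tonelli_F (m2 := P) f mf f0.
move=> /(measurable_funS measurableT (@subsetT _ (X : set (borel_rV R K)))).
apply: eq_measurable_fun => u uX.
rewrite /fubini_F unlock; apply: eq_integral => w _.
by rewrite fE /patch uX.
Qed.

End expected_hellinger.

(** * Exponentially weighted second moments of normal laws *)

Section shift.
Context (R : realType).
Notation leb := (@lebesgue_measure R).

Lemma ge0_integral_shift (G : R -> R) (a : R) :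
  continuous G -> (forall x, 0 <= G x) ->
  (\int[leb]_x (G x)%:E = \int[leb]_x (G (x + a))%:E)%E.
Proof.
move=> cG G0; pose F (x : R^o) := x + a.
have F'E : F^`()%classic = cst 1.
  apply/funext => x.
  by rewrite /F derive1E deriveD// derive_id derive_cst addr0.
rewrite (@increasing_ge0_integration_by_substitutionT _ F).
- by apply: eq_integral => x _; rewrite F'E !fctE mulr1.
- by move=> x y xy; rewrite /F ltrD2r.
- by rewrite F'E => ?; exact: cvg_cst.
- by rewrite F'E; exact: is_cvg_cst.
- by rewrite F'E; exact: is_cvg_cst.
- by move=> x; apply: derivableD.
- exact: cvg_addrr_Ny.
- exact: cvg_addrr.
- exact: cG.
- exact: G0.
Qed.

End shift.

Section gaussian.
Context (R : realType).
Notation leb := (@lebesgue_measure R).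
Variables (m s : R).
Hypothesis s0 : 0 < s.
Let nu := normal_prob m s.
Let p := normal_pdf m s.

Lemma ge0_integral_normal (f : R -> R) : measurable_fun setT f ->
  (forall x, 0 <= f x) ->
  (\int[nu]_x (f x)%:E = \int[leb]_x (f x * p x)%:E)%E.
Proof.
move=> mf f0.
have dom : nu `<< leb by exact: normal_prob_dominates.
rewrite -(@Radon_Nikodym_SigmaFinite.change_of_variables _ _ _ nu leb)//.
  2: exact/measurable_EFinP.
apply: ae_eq_integral => //.
- apply: emeasurable_funM; first exact/measurable_EFinP.
  by apply: measurable_int; exact: Radon_Nikodym_SigmaFinite.f_integrable.
- apply/measurable_EFinP; apply: measurable_funM => //.
  exact: measurable_normal_pdf.
have : ae_eq leb setT (Radon_Nikodym_SigmaFinite.f nu leb) (EFin \o p).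
  apply: integral_ae_eq => //.
  - exact: Radon_Nikodym_SigmaFinite.f_integrable.
  - by apply/measurable_EFinP; exact: measurable_normal_pdf.
  - move=> E _ mE.
    by rewrite -(Radon_Nikodym_SigmaFinite.f_integral dom mE).
by apply: filterS => x /= + _ => /(_ I) ->; rewrite EFinM.
Qed.

(** The density is at most [1 / (s * sqrt (2 * pi))], so an interval of length [s]
    has mass at most [1 / sqrt (2 * pi)]. *)
Lemma normal_itv_le (c : R) :
  (nu `[(c - s / 2)%R, (c + s / 2)%R]%classic <= (2^-1)%:E)%E.
Proof.
apply: (@le_trans _ _ (\int[leb]_(x in `[(c - s / 2)%R, (c + s / 2)%R])
    (normal_peak s)%:E)%E).
  apply: ge0_le_integral => //.
  - by move=> x _; rewrite lee_fin normal_pdf_ge0.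
  - apply/measurable_EFinP; apply: measurable_funTS.
    exact: measurable_normal_pdf.
  - by move=> x _; rewrite lee_fin normal_pdf_ub// gt_eqF.
rewrite integral_cst//= lebesgue_measure_itv/= lte_fin ltrD2l gtrN ?divr_gt0//.
rewrite -EFinD -EFinM lee_fin.
have -> : c + s / 2 - (c - s / 2) = s by field.
rewrite /normal_peak mulrC ler_pdivrMr ?sqrtr_gt0; last first.
  by rewrite mulrn_wgt0// mulr_gt0 ?pi_gt0// exprn_gt0.
have -> : s = Num.sqrt (s ^+ 2) by rewrite sqrtr_sqr ger0_norm// ltW.
have -> : 2^-1 = Num.sqrt (2^-1 ^+ 2) :> R by rewrite sqrtr_sqr ger0_norm.
rewrite -sqrtrM ?sqr_ge0// ler_wsqrtr// sqrtr_sqr (ger0_norm (ltW s0)).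
have : 0 < s ^+ 2 by rewrite exprn_gt0.
have := pi_ge2 R.
rewrite -mulr_natr; set q := s ^+ 2; set pp := pi => pi2 q0.
suff : q * 2 <= q * pp by lra.
by rewrite ler_pM2l//; lra.
Qed.

(** At least half of the mass lies at distance [s / 2] or more from [c], by
    [normal_itv_le], and contributes at least [s^2 / 4]. *)
Lemma variance_lower (c : R) :
  ((s ^+ 2 / 8)%:E <= \int[nu]_x ((x - c) ^+ 2)%:E)%E.
Proof.
set I := `[(c - s / 2), (c + s / 2)]%classic.
have mI : measurable I by exact: measurable_itv.
have msq : measurable_fun setT (fun x : R => (x - c) ^+ 2).
  by apply: measurable_funX; exact: measurable_funB.
have q0 : 0 <= s ^+ 2 / 4 by rewrite divr_ge0// sqr_ge0.
have far (x : R) : x < c - s / 2 \/ c + s / 2 < x -> s ^+ 2 / 4 <= (x - c) ^+ 2.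
  move: (s0) => s1; case=> h.
    have : 0 <= (c - s / 2 - x) * (c + s / 2 - x) by apply: mulr_ge0; lra.
    by lra.
  have : 0 <= (x - (c + s / 2)) * (x - (c - s / 2)) by apply: mulr_ge0; lra.
  by lra.
have le1 : ((s ^+ 2 / 4)%:E <=
    \int[nu]_x ((x - c) ^+ 2 + s ^+ 2 / 4 * \1_I x)%:E)%E.
  have -> : ((s ^+ 2 / 4)%:E = \int[nu]_x (s ^+ 2 / 4)%:E)%E.
    by rewrite integral_cst//= probability_setT mule1.
  apply: ge0_le_integral => //.
  - apply/measurable_EFinP; apply: measurable_funD => //.
    by apply: measurable_funM => //; exact: measurable_indic.
  - move=> x _; rewrite lee_fin indicE; case: (boolP (x \in I)) => xI.
      by rewrite mulr1 lerDr sqr_ge0.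
    rewrite mulr0 addr0.
    apply: far; have /negP : ~ I x.
      by move=> Ix; move/negP: xI; apply; rewrite inE.
    rewrite /I /= in_itv/= negb_and -!ltNge => /orP[]; [by left|by right].
move: le1; under eq_integral do rewrite EFinD (EFinM (s ^+ 2 / 4)).
rewrite ge0_integralD//; last 4 first.
- by move=> x _; rewrite lee_fin sqr_ge0.
- exact/measurable_EFinP.
- by move=> x _; rewrite -EFinM lee_fin mulr_ge0.
- by apply/measurable_EFinP; apply: measurable_funM.
rewrite ge0_integralZl//; last first.
  by apply: measurableT_comp => //; exact: measurable_indic.
rewrite integral_indic// setIT => le1.
have le2 : ((s ^+ 2 / 4)%:E * nu I <= (s ^+ 2 / 8)%:E)%E.
  apply: (@le_trans _ _ ((s ^+ 2 / 4)%:E * (2^-1)%:E)%E).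
    by rewrite lee_wpmul2l ?lee_fin//; exact: normal_itv_le.
  by rewrite -EFinM lee_fin; lra.
have := le_trans le1 (leeD2l _ le2).
case: (\int[nu]_x _)%E => [r| |] h.
- by move: h; rewrite -EFinD !lee_fin; lra.
- exact: leey.
- by move: h; rewrite addNye leeNy_eq.
Qed.

(** Completing the square: [exp (- x)] times the density of mean [m] and variance
    [s^2] is a constant times the density of mean [m - s^2] and the same
    variance. *)
Lemma exp_tilt (c : R) :
  (\int[nu]_x ((x - c) ^+ 2 * expR (- (x - c)))%:E =
   (expR (c - m + s ^+ 2 / 2))%:E * \int[nu]_x ((x - s ^+ 2 - c) ^+ 2)%:E)%E.
Proof.
have msq b : measurable_fun setT (fun x : R => (x - b) ^+ 2).
  by apply: measurable_funX; exact: measurable_funB.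
rewrite ge0_integral_normal; last 2 first.
- apply: measurable_funM => //; apply: measurableT_comp => //.
  by apply: measurableT_comp => //; exact: measurable_funB.
- by move=> x; rewrite mulr_ge0 ?sqr_ge0 ?expR_ge0.
rewrite [X in (_ * X)%E]ge0_integral_normal; last 2 first.
- apply: measurable_funX; do ![apply: measurable_funB => //].
- by move=> x; exact: sqr_ge0.
rewrite [X in (_ * X)%E](@ge0_integral_shift _ _ (s ^+ 2)); last 2 first.
- move=> x; apply: cvgM; last by apply: continuous_normal_pdf; rewrite gt_eqF.
  apply: (@continuous_comp _ _ _ (fun x => x - s ^+ 2 - c) (fun x => x ^+ 2)).
    apply: (@cvgB _ R^o) => //; last exact: cvg_cst.
    by apply: (@cvgB _ R^o) => //; exact: cvg_cst.
  exact: sqr_continuous.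
- by move=> x; rewrite mulr_ge0 ?sqr_ge0 ?normal_pdf_ge0.
rewrite -ge0_integralZl//; last 2 first.
- apply/measurable_EFinP; apply: measurable_funM.
    apply: measurable_funX; do ![apply: measurable_funB => //].
    exact: measurable_funD.
  apply: measurableT_comp; first exact: measurable_normal_pdf.
  exact: measurable_funD.
- by move=> x _; rewrite lee_fin mulr_ge0 ?sqr_ge0 ?normal_pdf_ge0.
apply: eq_integral => x _; rewrite -EFinM; congr EFin.
have -> : x + s ^+ 2 - s ^+ 2 = x by rewrite addrK.
rewrite /p !normal_pdfE ?gt_eqF// /normal_fun.
rewrite -mulrA [RHS]mulrCA; congr (_ * _).
rewrite [RHS]mulrCA [LHS]mulrCA; congr (_ * _).
rewrite -!expRD; congr expR; rewrite -mulr_natr; field.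
by rewrite gt_eqF.
Qed.

(** The shift by [s^2] in [exp_tilt] adds at most [2 * s^4] to twice the second
    moment around [c], and [s^4 <= S * s^2] is in turn controlled by that moment
    through [variance_lower]. *)
Lemma exp_tilt_le (c B S : R) : `|c - m| <= B -> s ^+ 2 <= S ->
  (\int[nu]_x ((x - c) ^+ 2 * expR (- (x - c)))%:E <=
   (expR (B + S / 2) * (2 + 16 * S))%:E * \int[nu]_x ((x - c) ^+ 2)%:E)%E.
Proof.
move=> cB sS.
have S0 : 0 <= S by rewrite (le_trans _ sS)// sqr_ge0.
have msq b : measurable_fun setT (fun x : R => (x - b) ^+ 2).
  by apply: measurable_funX; exact: measurable_funB.
have V0 : (0 <= \int[nu]_x ((x - c) ^+ 2)%:E)%E.
  by apply: integral_ge0 => x _; rewrite lee_fin sqr_ge0.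
rewrite exp_tilt EFinM -muleA; apply: lee_pmul.
- by rewrite lee_fin expR_ge0.
- by apply: integral_ge0 => x _; rewrite lee_fin sqr_ge0.
- rewrite lee_fin ler_expR lerD//; first by rewrite (le_trans (ler_norm _)).
  by rewrite ler_pM2r.
apply: (@le_trans _ _ (\int[nu]_x
    (2%:E * ((x - c) ^+ 2)%:E + (2 * s ^+ 2 ^+ 2)%:E))%E).
  apply: ge0_le_integral => //.
  - by move=> x _; rewrite lee_fin sqr_ge0.
  - apply/measurable_EFinP; apply: measurable_funX.
    by do ![apply: measurable_funB => //].
  - apply: emeasurable_funD => //; apply: emeasurable_funM => //.
    by apply: measurableT_comp => //; exact: msq.
  - move=> x _; rewrite -EFinM -EFinD lee_fin.
    set q := s ^+ 2; have := sqr_ge0 (x - c + q); nra.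
rewrite ge0_integralD//; last 3 first.
- by move=> x _; rewrite -EFinM lee_fin mulr_ge0// sqr_ge0.
- by apply: emeasurable_funM => //; apply: measurableT_comp => //; exact: msq.
- by move=> x _; rewrite lee_fin mulr_ge0// sqr_ge0.
rewrite ge0_integralZl//; last 2 first.
- by apply: measurableT_comp => //; exact: msq.
- by move=> x _; rewrite lee_fin sqr_ge0.
rewrite integral_cst//= probability_setT mule1.
have := variance_lower c.
have : 0 <= s ^+ 2 by exact: sqr_ge0.
move: V0; case: (\int[nu]_x _)%E => [r| |]//=; last first.
  by move=> *; rewrite [in leRHS]gt0_muley ?leey// lte_fin; lra.
rewrite -!EFinM -EFinD !lee_fin; move: (s ^+ 2) sS => q qS r0 q0 qr.
have : q * q <= S * (8 * r) by apply: ler_pM => //; lra.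
by rewrite expr2; lra.
Qed.

End gaussian.

Section exponential_lipschitz.
Context (R : realType).

(** The mean value theorem for [exp (- t / 2)], where the derivative is bounded by
    its larger endpoint value; [a >= 0] bounds the factor [exp (- a)]. *)
Lemma sqr_expR_sub_le (a t : R) : 0 <= a ->
  (expR (- 2^-1 * a) - expR (- 2^-1 * t)) ^+ 2 <=
  4^-1 * (t - a) ^+ 2 * (1 + expR (- (t - a))).
Proof.
move=> a0; set x := t - a.
have E (y : R) : (1 - expR (- y)) ^+ 2 <= y ^+ 2 * (1 + expR (- (2 * y))).
  have E2 : expR (- (2 * y)) = expR (- y) ^+ 2.
    by rewrite expr2 -expRD; congr expR; ring.
  rewrite E2; have := expR_ge1Dx (- y); have := expR_ge1Dx y.
  have : expR y * expR (- y) = 1 by rewrite -expRD subrr expR0.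
  have := expR_gt0 y; have := expR_gt0 (- y).
  move: (expR y) (expR (- y)) => p q q0 p0 pq yp yq.
  have [y0|/ltW y0] := leP 0 y.
    have q1 : 0 <= 1 - q by nra.
    have : (1 - q) ^+ 2 <= y ^+ 2 by rewrite ler_sqr ?nnegrE//; lra.
    have : 0 <= y ^+ 2 * q ^+ 2 by rewrite mulr_ge0 ?sqr_ge0.
    by lra.
  have q1 : 0 <= q - 1 by lra.
  have q2 : q - 1 <= - y * q.
    have : q * (1 + y) <= q * p by rewrite ler_wpM2l// ltW.
    by lra.
  have : (q - 1) ^+ 2 <= (- y * q) ^+ 2 by rewrite ler_sqr ?nnegrE//; nra.
  have := sqr_ge0 y; lra.
have -> : expR (- 2^-1 * t) = expR (- 2^-1 * a) * expR (- (2^-1 * x)).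
  by rewrite -expRD; congr expR; rewrite /x; ring.
rewrite -[X in X - _]mulr1 -mulrBr exprMn.
apply: (@le_trans _ _ ((1 - expR (- (2^-1 * x))) ^+ 2)).
  rewrite ler_piMl ?sqr_ge0// exprn_ile1 ?expR_ge0//.
  by rewrite -[leRHS]expR0 ler_expR; lra.
rewrite (le_trans (E (2^-1 * x)))//.
have -> : 2 * (2^-1 * x) = x by field.
by rewrite exprMn ler_wpM2r ?addr_ge0 ?expR_ge0// ler_wpM2r ?sqr_ge0//; lra.
Qed.

End exponential_lipschitz.

Section law.
Context (R : realType) d (Omega : measurableType d) (P : probability Omega R).

Lemma expectation_eq_law (Y : Omega -> R)
    (nu : {measure set (measurableTypeR R) -> \bar R})
    (f : R -> R) :
  measurable_fun setT Y ->
  (forall B, measurable B -> P (Y @^-1` B) = nu B) ->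
  measurable_fun setT f -> (forall x, 0 <= f x) ->
  ('E_P[fun w => f (Y w)] = \int[nu]_x (f x)%:E)%E.
Proof.
move=> mY law mf f0; rewrite unlock.
rewrite -(@ge0_integral_pushforward _ _ Omega (measurableTypeR R) _ Y mY P setT
  (EFin \o f))//.
- by apply: eq_measure_integral => A mA _; exact: law.
- exact/measurable_EFinP.
- by move=> x _; rewrite lee_fin.
Qed.

(** The constant depends only on the bounds [B] on the bias [|a - m|] and [S] on
    the variance.  The Dirac case [v = 0] is separate, and occurs at the design
    points. *)
Lemma gaussian_expR_sub_le (Y : Omega -> R) (a m v B S : R) :
  measurable_fun setT Y ->
  (forall A, measurable A -> P (Y @^-1` A) = normal_law m v A) ->
  0 <= a -> 0 <= v -> `|a - m| <= B -> v <= S ->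
  ('E_P[fun w => ((expR (- 2^-1 * a) - expR (- 2^-1 * Y w)) ^+ 2)%R] <=
   (4^-1 * (1 + expR (B + S / 2) * (2 + 16 * S)))%:E *
   'E_P[fun w => (`|a - Y w| ^+ 2)%R])%E.
Proof.
move=> mY law a0 v0 aB vS.
have S0 : 0 <= S by exact: le_trans vS.
pose C := expR (B + S / 2) * (2 + 16 * S).
have mf : measurable_fun setT (fun t : R =>
    (expR (- 2^-1 * a) - expR (- 2^-1 * t)) ^+ 2).
  apply: measurable_funX; apply: measurable_funB => //.
  by apply: measurableT_comp => //; exact: measurable_funM.
have mg : measurable_fun setT (fun t : R => `|a - t| ^+ 2).
  apply: measurable_funX; apply: measurableT_comp => //; exact: measurable_funB.
have [v00|vN0] := eqVneq v 0.
  have law' A : measurable A -> P (Y @^-1` A) = \d_m A.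
    by move=> mA; rewrite law// /normal_law v00 eqxx.
  pose dm := @dirac _ (measurableTypeR R) m R.
  rewrite (@expectation_eq_law Y dm _ mY law' mf);
    last by move=> x; exact: sqr_ge0.
  rewrite (@expectation_eq_law Y dm _ mY law' mg);
    last by move=> x; exact: sqr_ge0.
  rewrite !integral_dirac//; last 2 first.
  - exact/measurable_EFinP.
  - exact/measurable_EFinP.
  rewrite !diracT !mul1e -EFinM lee_fin.
  rewrite (le_trans (sqr_expR_sub_le _ a0))//.
  have -> : (m - a) ^+ 2 = `|a - m| ^+ 2.
    by rewrite -normrX ger0_norm ?sqr_ge0//; ring.
  rewrite mulrAC ler_wpM2r ?sqr_ge0// ler_wpM2l// lerD2l.
  apply: (@le_trans _ _ (expR (B + S / 2))).
    rewrite ler_expR; have := ler_norm (a - m); lra.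
  by rewrite ler_peMr ?expR_ge0//; lra.
have vp : 0 < v by rewrite lt_neqAle eq_sym vN0.
pose s := Num.sqrt v.
have s0 : 0 < s by rewrite sqrtr_gt0.
have sv : s ^+ 2 = v by rewrite sqr_sqrtr.
have law' A : measurable A -> P (Y @^-1` A) = normal_prob m s A.
  by move=> mA; rewrite law// /normal_law (negbTE vN0).
rewrite (@expectation_eq_law Y (normal_prob m s) _ mY law' mf);
  last by move=> x; exact: sqr_ge0.
rewrite (@expectation_eq_law Y (normal_prob m s) _ mY law' mg);
  last by move=> x; exact: sqr_ge0.
have tilt := @exp_tilt_le _ m s s0 a B S aB.
rewrite sv in tilt; have {}tilt := tilt vS.
have mq : measurable_fun setT (fun x : R => (x - a) ^+ 2).
  by apply: measurable_funX; exact: measurable_funB.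
have me : measurable_fun setT (fun x : R => (x - a) ^+ 2 * expR (- (x - a))).
  apply: measurable_funM => //; apply: measurableT_comp => //.
  by apply: measurableT_comp => //; exact: measurable_funB.
apply: (@le_trans _ _ (\int[normal_prob m s]_x
   ((4^-1)%:E * (((x - a) ^+ 2)%:E + ((x - a) ^+ 2 * expR (- (x - a)))%:E)))%E).
  apply: ge0_le_integral => //.
  - by move=> x _; rewrite lee_fin sqr_ge0.
  - exact/measurable_EFinP.
  - apply: emeasurable_funM => //.
    by apply: emeasurable_funD; exact/measurable_EFinP.
  - move=> x _; rewrite -EFinD -EFinM lee_fin.
    rewrite (le_trans (sqr_expR_sub_le _ a0))// le_eqVlt; apply/orP; left.
    by apply/eqP; ring.
rewrite ge0_integralZl//; last 2 first.
- apply: emeasurable_funD; exact/measurable_EFinP.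
- move=> x _; apply: adde_ge0; rewrite lee_fin ?sqr_ge0//.
  by rewrite mulr_ge0 ?sqr_ge0 ?expR_ge0.
rewrite EFinM -muleA lee_wpmul2l ?lee_fin//.
rewrite ge0_integralD//; last 4 first.
- by move=> x _; rewrite lee_fin sqr_ge0.
- exact/measurable_EFinP.
- by move=> x _; rewrite lee_fin mulr_ge0 ?sqr_ge0 ?expR_ge0.
- exact/measurable_EFinP.
have -> : (\int[normal_prob m s]_x (`|a - x| ^+ 2)%:E =
    \int[normal_prob m s]_x ((x - a) ^+ 2)%:E)%E.
  apply: eq_integral => x _; congr EFin.
  by rewrite -normrX ger0_norm ?sqr_ge0//; ring.
have C0 : 0 <= C by rewrite mulr_ge0 ?expR_ge0//; lra.
rewrite EFinD ge0_muleDl ?lee_fin// mul1e leeD2l//.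
Qed.

End law.

(** * From pointwise mean square bounds to L2 bounds *)

Section lyapunov.
Context (R : realType) d (Omega : measurableType d) (P : probability Omega R).

(** Hoelder's inequality for [xi^2] and the constant 1, whose norm is 1 because
    [P] is a probability. *)
Lemma lyapunov_sqr (xi : Omega -> R) (delta : R) :
  measurable_fun setT xi -> (forall w, 0 <= xi w) -> 0 < delta ->
  ('E_P[fun w => (xi w ^+ 2)%R] <=
   ('E_P[fun w => (xi w `^ (2 + delta))%R] `^ (2 + delta)^-1) `^ 2)%E.
Proof.
move=> mxi xi0 d0; rewrite unlock.
pose p := (2 + delta) / 2; pose q := (2 + delta) / delta.
have p0 : 0 < p by rewrite divr_gt0//; lra.
have q0 : 0 < q by rewrite divr_gt0//; lra.
have pq : p^-1 + q^-1 = 1 by rewrite /p /q; field; rewrite gt_eqF//=; lra.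
have mx2 : measurable_fun setT (fun w => xi w ^+ 2) by exact: measurable_funX.
have := hoelder P mx2 (measurable_cst (1 : R)) p0 q0 pq.
rewrite Lnorm1.
have -> : ('N[P]_q%:E[(EFin \o cst 1%R)] = 1)%E.
  rewrite -(poweR1r q^-1) -(@probability_setT _ _ _ P).
  exact: Lnorm_cst1.
rewrite mule1 => H.
have -> : (\int[P]_w (xi w ^+ 2)%:E =
   \int[P]_x `|(EFin \o ((fun w => xi w ^+ 2) \* cst 1)%R) x|)%E.
  by apply: eq_integral => w _; rewrite /= mulr1 ger0_norm ?sqr_ge0.
apply: (le_trans H); rewrite unlock.
have -> : (\int[P]_x `|(EFin \o (fun w => (xi w ^+ 2)%R)) x| `^ p =
   \int[P]_w (xi w `^ (2 + delta))%:E)%E.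
  apply: eq_integral => w _; rewrite /= ger0_norm ?sqr_ge0//.
  by rewrite -powR_mulrn// -powRrM; congr (EFin (_ `^ _)); rewrite /p; field.
have -> : p^-1 = (2 + delta)^-1 * 2 by rewrite /p invf_div mulrC.
by rewrite poweRrM.
Qed.

End lyapunov.

Section hellinger_L2.
Context (R : realType) (K : nat) (X : set 'rV[R]_K).
Context d (Omega : measurableType d) (P : probability Omega R).
Variable mu0 : probability (borel_rV R K) R.
Hypotheses (cX : compact X) (X1 : mu0 X = 1%E).
Variables (phi : 'rV[R]_K -> R) (M : R) (psi xi : 'rV[R]_K -> Omega -> R).
Hypotheses (mphi : @measurable_fun _ _ (borel_rV R K) _ X phi)
  (phiM : forall u, X u -> `|phi u| <= M).
Hypotheses (mpsi : forall u, X u -> measurable_fun setT (psi u))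
  (cpsi : continuous_paths X psi).
Hypotheses (mxi : forall u, X u -> measurable_fun setT (xi u))
  (xi0 : forall u w, 0 <= xi u w).

(** This reduces both estimates of the theorem to a mean square bound at each
    point of [X], with a constant independent of [delta]. *)
Lemma hellinger_le_L2norm (C delta : R) : 0 < C -> 0 < delta ->
  (forall u, X u ->
    ('E_P[fun w => ((expR (- 2^-1 * phi u) - expR (- 2^-1 * psi u w)) ^+ 2)%R]
     <= C%:E * 'E_P[fun w => (xi u w ^+ 2)%R])%E) ->
  ('E_P[fun w => (hellinger mu0 X (posterior mu0 X phi)
                    (posterior mu0 X (psi^~ w)) ^+ 2)%R] `^ 2^-1
   <= (Num.sqrt (C / evidence mu0 X phi))%:E *
      L2norm mu0 X (fun u =>
        'E_P[fun w => (xi u w `^ (2 + delta))%R] `^ (2 + delta)^-1))%E.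
Proof.
move=> C0 d0 H.
have mX : measurable (X : set (borel_rV R K)) by exact: measurable_compact_rV.
have Z0 : 0 < evidence mu0 X phi by exact: (evidence_gt0 mX X1 mphi phiM).
have CZ0 : 0 <= C / evidence mu0 X phi by rewrite divr_ge0// ltW.
set h := fun u : 'rV[R]_K => _.
pose EF u : \bar R :=
  'E_P[fun w => ((expR (- 2^-1 * phi u) - expR (- 2^-1 * psi u w)) ^+ 2)%R]%E.
have EF0 u : (0 <= EF u)%E.
  by apply: expectation_ge0 => w; exact: sqr_ge0.
have h0 u : (0 <= h u)%E by exact: poweR_ge0.
have le_int : (\int[mu0]_(u in X) EF u <=
    C%:E * \int[mu0]_u (`|(h \_ X) u| `^ 2))%E.
  (* The constant is pulled out of the integral of [EF], which is known to be
     measurable, and not out of that of [h]. *)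
  have -> : (\int[mu0]_(u in X) EF u =
      C%:E * \int[mu0]_(u in X) ((C^-1)%:E * EF u))%E.
    rewrite ge0_integralZl//.
    - by rewrite muleA -EFinM divff ?gt_eqF// mul1e.
    - exact: (measurable_expected_sqr _ cX mphi mpsi cpsi).
    - by rewrite lee_fin invr_ge0 ltW.
  rewrite lee_wpmul2l ?lee_fin ?(ltW C0)// integral_mkcond.
  apply: ge0_le_integral_nonmeasurable => u _.
    by apply: erestrict_ge0 => v _; rewrite mule_ge0// lee_fin invr_ge0 ltW.
  rewrite /patch; case: ifPn => [/set_mem Xu|_]; last exact: poweR_ge0.
  rewrite gee0_abs//.
  apply: (@le_trans _ _ ('E_P[fun w => (xi u w ^+ 2)%R])%E).
    apply: (@le_trans _ _ ((C^-1)%:E *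
        (C%:E * 'E_P[fun w => (xi u w ^+ 2)%R]))%E).
      by rewrite lee_wpmul2l ?lee_fin ?invr_ge0 ?(ltW C0)//; exact: H.
    by rewrite muleA -EFinM mulVf ?gt_eqF// mul1e.
  by apply: lyapunov_sqr => //; exact: mxi.
have -> : L2norm mu0 X h = ((\int[mu0]_u (`|(h \_ X) u| `^ 2)) `^ 2^-1)%E.
  by rewrite /L2norm unlock.
rewrite -powR12_sqrt// -poweR_EFin -poweRM; last 2 first.
- by rewrite lee_fin.
- by apply: integral_ge0 => u _; exact: poweR_ge0.
have I0 : (0 <= \int[mu0]_u (`|(h \_ X) u| `^ 2))%E.
  by apply: integral_ge0 => u _; exact: poweR_ge0.
apply: gt0_ler_poweR => //.
- by rewrite in_itv/= leey andbT expectation_ge0// => w; exact: sqr_ge0.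
- by rewrite in_itv/= leey andbT mule_ge0// lee_fin.
apply: (le_trans (expected_hellinger_le P cX X1 mphi phiM mpsi cpsi)).
by rewrite mulrC EFinM -muleA lee_wpmul2l// lee_fin invr_ge0 ltW.
Qed.

End hellinger_L2.

(** * The Gaussian likelihood is Lipschitz *)

Section euclidean_norm.
Context (R : realType) (n : nat).
Implicit Types v w : 'rV[R]_n.

Lemma enorm_ge0 v : 0 <= enorm v. Proof. exact: sqrtr_ge0. Qed.

Lemma sqr_enorm v : enorm v ^+ 2 = \sum_(i < n) v 0 i ^+ 2.
Proof. by rewrite sqr_sqrtr// sumr_ge0// => i _; exact: sqr_ge0. Qed.

Lemma cauchy_schwarz v w : \sum_(i < n) v 0 i * w 0 i <= enorm v * enorm w.
Proof.
set c := \sum_(i < n) _.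
have vE := sqr_enorm v; have wE := sqr_enorm w.
have zero (x : 'rV[R]_n) : enorm x = 0 -> forall i, x 0 i = 0.
  move=> x0 i; have := sqr_enorm x; rewrite x0 expr0n/= => /esym/eqP.
  rewrite psumr_eq0; last by move=> j _; exact: sqr_ge0.
  by move=> /allP/(_ i (mem_index_enum _)); rewrite sqrf_eq0 => /eqP.
have [v0|vN0] := eqVneq (enorm v) 0.
  by rewrite v0 mul0r /c big1// => i _; rewrite (zero _ v0) mul0r.
have [w0|wN0] := eqVneq (enorm w) 0.
  by rewrite w0 mulr0 /c big1// => i _; rewrite (zero _ w0) mulr0.
have pv : 0 < enorm v by rewrite lt_neqAle eq_sym vN0 enorm_ge0.
have pw : 0 < enorm w by rewrite lt_neqAle eq_sym wN0 enorm_ge0.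
have : 0 <= \sum_(i < n) (v 0 i * enorm w - w 0 i * enorm v) ^+ 2.
  by apply: sumr_ge0 => i _; exact: sqr_ge0.
have -> : \sum_(i < n) (v 0 i * enorm w - w 0 i * enorm v) ^+ 2 =
    2 * (enorm v * enorm w) * (enorm v * enorm w - c).
  transitivity (enorm w ^+ 2 * (\sum_(i < n) v 0 i ^+ 2) +
      enorm v ^+ 2 * (\sum_(i < n) w 0 i ^+ 2) - 2 * (enorm v * enorm w) * c).
    rewrite !mulr_sumr -big_split/= -sumrB; apply: eq_bigr => i _; ring.
  rewrite -vE -wE; ring.
by rewrite pmulr_rge0 ?subr_ge0// mulr_gt0// mulr_gt0.
Qed.

Lemma sqr_enorm_sub_le v w : (enorm v - enorm w) ^+ 2 <= enorm (v - w) ^+ 2.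
Proof.
have -> : enorm (v - w) ^+ 2 =
    enorm v ^+ 2 + enorm w ^+ 2 - 2 * (\sum_(i < n) v 0 i * w 0 i).
  rewrite !sqr_enorm mulr_sumr -big_split/= -sumrB; apply: eq_bigr => i _.
  rewrite !mxE; ring.
have := cauchy_schwarz v w; lra.
Qed.

Lemma sqr_enorm_sub_ub v w :
  enorm (v - w) ^+ 2 <= 2 * enorm v ^+ 2 + 2 * enorm w ^+ 2.
Proof.
rewrite !sqr_enorm !mulr_sumr -big_split/=; apply: ler_sum => i _.
by rewrite !mxE; have := sqr_ge0 (v 0 i + w 0 i); lra.
Qed.

End euclidean_norm.

Section gaussian_bump.
Context (R : realType).

(** If [p <= q] then [1 - exp (- x) <= x] bounds the difference by
    [c (q - p) (2 p + (q - p)) exp (- c p^2)], where [2 c p exp (- c p^2)] is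
    bounded uniformly in [p]; when [q - p >= 1] the difference is at most 1
    anyway. *)
Lemma gaussian_bump_lipschitz (c p q : R) : 0 <= c -> 0 <= p -> 0 <= q ->
  (expR (- (c * p ^+ 2)) - expR (- (c * q ^+ 2))) ^+ 2 <=
  (1 + 2 * c) ^+ 2 * (p - q) ^+ 2.
Proof.
move=> c0.
wlog pq : p q / p <= q => [hw p0 q0|p0 q0].
  have [pq|/ltW qp] := leP p q; first exact: hw.
  by have := hw _ _ qp q0 p0; lra.
set a := expR _; set b := expR _.
have a0 : 0 < a by exact: expR_gt0.
have b0 : 0 < b by exact: expR_gt0.
have ba : b <= a by rewrite ler_expR lerN2 ler_wpM2l// ler_sqr.
have a1 : a * (1 + c * p ^+ 2) <= 1.
  have E1 : a * expR (c * p ^+ 2) = 1 by rewrite -expRD addNr expR0.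
  by rewrite -[leRHS]E1 ler_wpM2l ?(ltW a0)// expR_ge1Dx.
have ab : a - b <= a * (c * (q ^+ 2 - p ^+ 2)).
  have -> : b = a * expR (- (c * (q ^+ 2 - p ^+ 2))).
    by rewrite -expRD; congr expR; ring.
  have := expR_ge1Dx (- (c * (q ^+ 2 - p ^+ 2))).
  by move=> /(ler_wpM2l (ltW a0)); lra.
have cp0 : 0 <= c * p ^+ 2 by rewrite mulr_ge0// sqr_ge0.
have a_le1 : a <= 1.
  have : 0 <= a * (c * p ^+ 2) by rewrite mulr_ge0// ltW.
  by lra.
suff h : a - b <= (1 + 2 * c) * (q - p).
  rewrite -exprMn -[leRHS]sqrrN ler_sqr ?nnegrE ?subr_ge0//; first by lra.
  by rewrite -mulrN opprB mulr_ge0// ?subr_ge0//; lra.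
have [big|/ltW small] := leP 1 (q - p).
  have : 0 <= c * (q - p) by rewrite mulr_ge0//; lra.
  by lra.
have cap : 2 * c * p * a <= 1 + c.
  have : 2 * c * p <= (1 + c) * (1 + c * p ^+ 2).
    have : 0 <= c * (p - 1) ^+ 2 by rewrite mulr_ge0// sqr_ge0.
    have : 0 <= c * (c * p ^+ 2) by rewrite mulr_ge0.
    by lra.
  move=> /(ler_wpM2r (ltW a0)) /le_trans; apply.
  have : (1 + c) * (a * (1 + c * p ^+ 2)) <= (1 + c) * 1.
    by rewrite ler_wpM2l//; lra.
  by lra.
set t := q - p in small *.
have t0 : 0 <= t by rewrite subr_ge0.
have qE : q = p + t by rewrite /t; ring.
apply: (le_trans ab).
have -> : a * (c * (q ^+ 2 - p ^+ 2)) = t * (2 * c * p * a + c * (a * t)).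
  by rewrite qE; ring.
rewrite mulrC ler_wpM2r//.
have : c * (a * t) <= c * 1.
  by rewrite ler_wpM2l// mulr_ile1// ltW.
by lra.
Qed.

Lemma expR_misfit_lipschitz (J : nat) (y g z : 'rV[R]_J) (sigma2 : R) :
  0 < sigma2 ->
  (expR (- 2^-1 * misfit y sigma2 g) - expR (- 2^-1 * misfit y sigma2 z)) ^+ 2
  <= (1 + (2 * sigma2)^-1) ^+ 2 * enorm (g - z) ^+ 2.
Proof.
move=> s0; pose c := (4 * sigma2)^-1.
have c0 : 0 <= c by rewrite invr_ge0 mulr_ge0// ltW.
have E x : - 2^-1 * misfit y sigma2 x = - (c * enorm (y - x) ^+ 2).
  by rewrite /misfit /c; field; rewrite gt_eqF.
rewrite !E.
apply: (le_trans (gaussian_bump_lipschitz c0 (enorm_ge0 _) (enorm_ge0 _))).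
have -> : (2 * sigma2)^-1 = 2 * c by rewrite /c; field; rewrite gt_eqF.
rewrite ler_wpM2l ?sqr_ge0//.
apply: (le_trans (sqr_enorm_sub_le _ _)).
have -> : y - g - (y - z) = - (g - z) by rewrite !opprB addrC addrA subrK.
rewrite !sqr_enorm le_eqVlt; apply/orP; left; apply/eqP.
by apply: eq_bigr => i _; rewrite !mxE sqrrN.
Qed.

End gaussian_bump.

(** * Regularity of the misfit and the main estimate *)

Section misfit_regularity.
Context (R : realType) (J : nat) (y : 'rV[R]_J) (sigma2 : R).

Lemma misfitE (z : 'rV[R]_J) :
  misfit y sigma2 z = (2 * sigma2)^-1 * \sum_(j < J) (y 0 j - z 0 j) ^+ 2.
Proof.
rewrite /misfit sqr_enorm mulrC; congr (_ * _).
by apply: eq_bigr => j _; rewrite !mxE.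
Qed.

Lemma continuous_misfit (T : topologicalType) (f : T -> 'rV[R]_J) :
  (forall j, continuous (fun t => f t 0 j)) ->
  continuous (fun t => misfit y sigma2 (f t)).
Proof.
move=> cf.
have -> : (fun t => misfit y sigma2 (f t)) =
    (fun t => (2 * sigma2)^-1 * \sum_(j < J) (y 0 j - f t 0 j) ^+ 2).
  by apply/funext => t; rewrite misfitE.
move=> t; apply: cvgM; first exact: cvg_cst.
apply: (@cvg_big _ _ +%R) => [|j _]; first exact: add_continuous.
apply: (@continuous_comp _ _ _ (fun t => y 0 j - f t 0 j) (fun x => x ^+ 2)).
  apply: (@cvgB _ R^o); first exact: cvg_cst.
  exact: cf.
exact: sqr_continuous.
Qed.

Lemma measurable_coord (i : 'I_J) :
  measurable_fun [set: borel_rV R J]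
    (fun v : borel_rV R J => (v : 'rV[R]_J) 0 i).
Proof.
apply: (measurability _ (RGenOInfty.measurableE R)).
move=> _ [_ [a ->]] <-; rewrite setTI; apply: measurable_open_rV.
apply: open_comp; last exact: interval_open.
by move=> v _; exact: coord_continuous.
Qed.

Lemma measurable_sqr_enorm_sub d (T : measurableType d) (D : set T)
    (f g : T -> 'rV[R]_J) :
  (forall j, measurable_fun D (fun t => f t 0 j)) ->
  (forall j, measurable_fun D (fun t => g t 0 j)) ->
  measurable_fun D (fun t => enorm (f t - g t) ^+ 2).
Proof.
move=> mf mg.
have -> : (fun t => enorm (f t - g t) ^+ 2) =
    (fun t => \sum_(j < J) (f t 0 j - g t 0 j) ^+ 2).
  by apply/funext => t; rewrite sqr_enorm; apply: eq_bigr => j _; rewrite !mxE.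
apply: measurable_sum => j; apply: measurable_funX; exact: measurable_funB.
Qed.

Lemma measurable_enorm_sub d (T : measurableType d) (D : set T)
    (f g : T -> 'rV[R]_J) :
  (forall j, measurable_fun D (fun t => f t 0 j)) ->
  (forall j, measurable_fun D (fun t => g t 0 j)) ->
  measurable_fun D (fun t => enorm (f t - g t)).
Proof.
move=> mf mg.
have -> : (fun t => enorm (f t - g t)) =
    (fun t => Num.sqrt (enorm (f t - g t) ^+ 2)).
  by apply/funext => t; rewrite sqrtr_sqr ger0_norm// enorm_ge0.
apply: measurableT_comp; first exact: measurable_sqrt.
exact: measurable_sqr_enorm_sub.
Qed.

Lemma measurable_misfit d (T : measurableType d) (D : set T)
    (f : T -> 'rV[R]_J) :
  (forall j, measurable_fun D (fun t => f t 0 j)) ->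
  measurable_fun D (fun t => misfit y sigma2 (f t)).
Proof.
by move=> mf; apply: measurable_funM => //; exact: measurable_sqr_enorm_sub.
Qed.

Lemma misfit_ge0 (z : 'rV[R]_J) : 0 < sigma2 -> 0 <= misfit y sigma2 z.
Proof. by move=> s0; rewrite divr_ge0 ?sqr_ge0// mulr_ge0// ltW. Qed.

Lemma misfit_ub (z : 'rV[R]_J) (C : R) : 0 < sigma2 -> enorm z <= C ->
  `|misfit y sigma2 z| <= (2 * enorm y ^+ 2 + 2 * C ^+ 2) / (2 * sigma2).
Proof.
move=> s0 zC; rewrite ger0_norm ?misfit_ge0// ler_wpM2r//.
  by rewrite invr_ge0 mulr_ge0// ltW.
rewrite (le_trans (sqr_enorm_sub_ub _ _))// lerD2l ler_wpM2l//.
have z0 := enorm_ge0 z.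
by rewrite ler_sqr ?nnegrE// (le_trans z0 zC).
Qed.

End misfit_regularity.

Lemma sup_on_le (R : realType) (T : Type) (X : set T) (f : T -> R) (e : R) :
  (sup_on X f <= e%:E)%E -> forall u, X u -> f u <= e.
Proof.
move=> H u Xu; rewrite -lee_fin; apply: le_trans H.
by apply: ereal_sup_ubound; exists u.
Qed.

Lemma gaussian_process_marginal (R : realType) (V : topologicalType) (X : set V)
    d (Omega : measurableType d) (P : probability Omega R)
    (f : V -> Omega -> R) m k (u : V) :
  gaussian_process X P f m k -> X u ->
  0 <= k u u /\ (forall B, measurable B ->
    P (f u @^-1` B) = normal_law (m u) (k u u) B).
Proof.
move=> [_ [_ psd] law] Xu; split.
  by have := psd 1 (fun=> u) (fun=> 1) (fun=> Xu); rewrite !big_ord1 !mul1r.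
move=> B mB; have := law 1 (fun=> u) (fun=> 1) (fun=> Xu) B mB.
rewrite !big_ord1 !mul1r => <-; congr (P _); apply/seteqP.
by split=> w /=; rewrite big_ord1 mul1r.
Qed.

Lemma cvg_seq_ub (R : realType) (e : nat -> R) (l : R) : e @ \oo --> l ->
  exists B, forall n, e n <= B.
Proof.
move=> el; have /cvg_seq_bounded[B [_ Be]] : cvgn e by apply/cvg_ex; exists l.
exists (B + 1) => n; rewrite (le_trans (ler_norm _))//.
by apply: Be => //; rewrite ltrDl.
Qed.

Theorem theorem4p11 (R : realType) (K J : nat) (K_gt0 : (0 < K)%N)
    (J_gt0 : (0 < J)%N)
    (X : set 'rV[R]_K) (G : 'rV[R]_K -> 'rV[R]_J) (y : 'rV[R]_J) (sigma2 : R)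
    (mu0 : probability (borel_rV R K) R)
    (* the initial Gaussian process models *)
    (d0 : measure_display) (Omega0 : measurableType d0)
    (P0 : probability Omega0 R)
    (Phi0 : 'rV[R]_K -> Omega0 -> R) (G0 : 'I_J -> 'rV[R]_K -> Omega0 -> R)
    (* the predictive Gaussian process models, for each design *)
    (d : measure_display) (Omega : seq 'rV[R]_K -> measurableType d)
    (P : forall D, probability (Omega D) R)
    (PhiN : forall D, 'rV[R]_K -> Omega D -> R)
    (GN : forall D, 'I_J -> 'rV[R]_K -> Omega D -> R)
    (mPhi : seq 'rV[R]_K -> 'rV[R]_K -> R)
    (mG : seq 'rV[R]_K -> 'rV[R]_K -> 'rV[R]_J)
    (k : seq 'rV[R]_K -> 'rV[R]_K -> 'rV[R]_K -> R)
    (* Null sequences bounding the three suprema in (i); fixed before the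
       constants C1 and C2, which may depend on them but not on the designs *)
    (eG ePhi ek : nat -> R) (CG : R) :
  let Phi := fun u => misfit y sigma2 (G u) in
  let mu_y := posterior mu0 X Phi in
  let mu_G := fun D w =>
    posterior mu0 X (fun u => misfit y sigma2 (\row_j GN D j u w)) in
  let mu_Phi := fun D w => posterior mu0 X (fun u => PhiN D u w) in
  0 < sigma2 ->
  compact X ->
  mu0 X = 1%E ->
  @measurable_fun _ _ (borel_rV R K) (borel_rV R J) X G ->
  continuous_paths X Phi0 ->
  (forall j, continuous_paths X (G0 j)) ->
  independent_fields X P0 G0 ->
  eG @ \oo --> 0 -> ePhi @ \oo --> 0 -> ek @ \oo --> 0 ->
  (* (ii) *)
  (sup_on X (fun u => enorm (G u)) <= CG%:E)%E ->
  exists C1 C2 : R, forall U : nat -> seq 'rV[R]_K,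
    (forall N, (0 < N)%N ->
      [/\ is_design X N (U N),
          gaussian_emulator X (P (U N)) (PhiN (U N)) (mPhi (U N))
            (GN (U N)) (mG (U N)) (k (U N)),
          (* (i) *)
          [/\ (sup_on X (fun u => enorm (G u - mG (U N) u)) <= (eG N)%:E)%E,
              (sup_on X (fun u => `|Phi u - mPhi (U N) u|%R) <= (ePhi N)%:E)%E &
              (sup_on X (fun u => k (U N) u u) <= (ek N)%:E)%E],
          (* (iii) *)
          sudakov_fernique X (P (U N)) P0
            (fun u w => PhiN (U N) u w - mPhi (U N) u) Phi0 &
          forall j, sudakov_fernique X (P (U N)) P0
            (fun u w => GN (U N) j u w - mG (U N) u 0 j) (G0 j)]) ->
    forall (delta : R) (N : nat), 0 < delta -> (0 < N)%N ->
      (('E_(P (U N))[fun w => (hellinger mu0 X mu_y (mu_G (U N) w) ^+ 2)%R]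
          `^ 2^-1
        <= C1%:E * L2norm mu0 X (fun u =>
             'E_(P (U N))[fun w =>
               (enorm (G u - \row_j GN (U N) j u w) `^ (2 + delta))%R]
             `^ (2 + delta)^-1))%E
      /\
       ('E_(P (U N))[fun w => (hellinger mu0 X mu_y (mu_Phi (U N) w) ^+ 2)%R]
          `^ 2^-1
        <= C2%:E * L2norm mu0 X (fun u =>
             'E_(P (U N))[fun w =>
               (`|Phi u - PhiN (U N) u w| `^ (2 + delta))%R]
             `^ (2 + delta)^-1))%E).
Proof.
move=> Phi mu_y mu_G mu_Phi s0 cX X1 mG_ _ _ _ eG0 ePhi0 ek0 GC.
have mX : measurable (X : set (borel_rV R K)) by exact: measurable_compact_rV.
have GCu := sup_on_le GC.
pose M := (2 * enorm y ^+ 2 + 2 * CG ^+ 2) / (2 * sigma2).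
have PhiM u : X u -> `|Phi u| <= M.
  by move=> Xu; apply: misfit_ub => //; exact: GCu.
have mGj j : @measurable_fun _ _ (borel_rV R K) _ X (fun u => G u 0 j).
  exact: (measurableT_comp (measurable_coord j) mG_).
have mPhi_ : @measurable_fun _ _ (borel_rV R K) _ X Phi.
  exact: measurable_misfit.
have [B ePhiB] := cvg_seq_ub ePhi0; have [S ekS] := cvg_seq_ub ek0.
pose Z := evidence mu0 X Phi.
pose CG1 := (1 + (2 * sigma2)^-1) ^+ 2.
pose CPhi := 4^-1 * (1 + expR (B + S / 2) * (2 + 16 * S)).
exists (Num.sqrt (CG1 / Z)), (Num.sqrt (CPhi / Z)) => U HU delta N delta0 N0.
have [_ [gPhi cPhi gG cG _] [_ supPhi supk] _ _] := HU N N0.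
have kS u : X u -> k (U N) u u <= S.
  by move=> Xu; rewrite (le_trans (sup_on_le supk Xu)).
have [mPhiN _ _] := gPhi.
have mGN j u : X u -> measurable_fun setT (GN (U N) j u).
  by have [+ _ _] := gG j; exact.
have X0 : exists u, X u.
  apply/not_existsP => XN; have : X = set0 by apply/seteqP; split => // u /XN.
  by move=> X00; move/eqP: X1; rewrite X00 measure0 eq_sym onee_eq0.
(* [S] bounds a variance at some point of [X], which has mass 1. *)
have S0 : 0 <= S.
  have [u Xu] := X0; have [k0 _] := gaussian_process_marginal gPhi Xu.
  exact: le_trans (kS u Xu).
have mxiG u : X u -> measurable_fun setT
    (fun w => enorm (G u - \row_j GN (U N) j u w)).
  move=> Xu; apply: measurable_enorm_sub => j; first exact: measurable_cst.
  by under eq_fun do rewrite mxE; exact: mGN.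
split.
- apply: (@hellinger_le_L2norm _ _ X _ (Omega (U N)) (P (U N)) mu0 cX X1 Phi M
    (fun u w => misfit y sigma2 (\row_j GN (U N) j u w))
    (fun u w => enorm (G u - \row_j GN (U N) j u w))) => //.
  + move=> u Xu; apply: measurable_misfit => j.
    by under eq_fun do rewrite mxE; exact: mGN.
  + move=> w; apply: continuous_misfit => j.
    under eq_fun do rewrite mxE; exact: cG.
  + by move=> u w; exact: enorm_ge0.
  + by rewrite exprn_gt0// ltr_pwDl// invr_ge0 mulr_ge0// ltW.
  + move=> u Xu; rewrite unlock -ge0_integralZl//; last 3 first.
    * by apply/measurable_EFinP; apply: measurable_funX; exact: mxiG.
    * by move=> w _; rewrite lee_fin sqr_ge0.
    * by rewrite lee_fin sqr_ge0.
    apply: ge0_le_integral_nonmeasurable => w _.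
      by rewrite lee_fin sqr_ge0.
    by rewrite -EFinM lee_fin; exact: expR_misfit_lipschitz.
- apply: (@hellinger_le_L2norm _ _ X _ (Omega (U N)) (P (U N)) mu0 cX X1 Phi M
    (PhiN (U N)) (fun u w => `|Phi u - PhiN (U N) u w|)) => //.
  + move=> u Xu; apply: measurableT_comp => //; apply: measurable_funB => //.
    exact: mPhiN.
  + rewrite mulr_gt0// ltr_pwDl// mulr_ge0 ?expR_ge0//; lra.
  + move=> u Xu; have [k0 law] := gaussian_process_marginal gPhi Xu.
    apply: gaussian_expR_sub_le law _ _ _ _ => //.
    * exact: mPhiN.
    * exact: misfit_ge0.
    * exact: le_trans (sup_on_le supPhi Xu) (ePhiB N).
    * exact: kS.
Qed.
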